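(* Let $\mathbb F_{q^2}$ be a finite field with $q^2$ elements of characteristic $p$ and let $G$ be a finite abelian group with exponent $n$. Write $G=Syl_p(G)\times H$, where $Syl_p(G)$ is the Sylow $p$-subgroup of $G$, and let $m$ be the exponent of $H$. Let $v$ be an integer with $v^2\equiv 1\pmod n$, and equip $\mathbb F_{q^2}G$ with the involution $*=\sigma_2:\mathbb F_{q^2}G\to\mathbb F_{q^2}G$, $\sum_{g\in G}a_gg\mapsto\sum_{g\in G}a_g^{q}g^v$. Then $\mathbb F_{q^2}G$ is $*$-clean if and only if there exists a positive integer $t$ such that $q^{2t}\equiv qv\pmod m$.
   Context: Here $q$ is a power of the prime $p$. $G$ is written multiplicatively, and $H$ is the subgroup of $G$ of order prime to $p$ complementing $Syl_p(G)$. A $*$-ring is a ring $R$ with a map $*:R\to R$ (an involution) satisfying $(x+y)^*=x^*+y^*$, $(xy)^*=y^*x^*$ and $(x^* )^*=x$ for all $x,y\in R$. A projection in a $*$-ring is an element $e$ with $e^*=e=e^2$. A $*$-ring is called $*$-clean if each of its elements is the sum of a unit and a projection. $\mathbb F_{q^2}G$ denotes the group ring of $G$ over $\mathbb F_{q^2}$. *)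

(* Defs.v *)
From HB Require Import structures.
From mathcomp Require Import all_boot all_order all_fingroup all_algebra all_solvable.
From mathcomp Require Import finfield.

Set Implicit Arguments.
Unset Strict Implicit.
Unset Printing Implicit Defensive.

Import GRing.Theory Num.Theory.
Local Open Scope ring_scope.

(* {ffun gT -> R} carries the pointwise product in the library; the alias
   keeps its additive structure and gets the convolution product instead. *)
Definition groupRing (R : nzRingType) (gT : finGroupType) : Type :=
  {ffun gT -> R}.

Section GroupRing.
Variables (R : nzRingType) (gT : finGroupType).
Local Notation RG := (groupRing R gT).
Implicit Types x y z : RG.

HB.instance Definition _ := GRing.Lmodule.copy RG {ffun gT -> R^o}.

Definition coef x : gT -> R := fun_of_fin (x : {ffun gT -> R}).

Definition basisElt (g : gT) : RG := [ffun h => (h == g)%:R].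

Definition grOne : RG := basisElt 1%g.

Definition grMul x y : RG :=
  [ffun g => \sum_(h : gT) coef x h * coef y (h^-1 * g)%g].

Lemma coefP x y : coef x =1 coef y -> x = y.
Proof. by move=> e; apply/ffunP. Qed.

Lemma coefD x y g : coef (x + y) g = coef x g + coef y g.
Proof. exact: ffunE. Qed.

Lemma coefZ a x g : coef (a *: x) g = a * coef x g.
Proof. exact: ffunE. Qed.

Lemma coef_sum I (r : seq I) (F : I -> RG) g :
  coef (\sum_(i <- r) F i) g = \sum_(i <- r) coef (F i) g.
Proof.
elim: r => [|i r IH]; first by rewrite !big_nil; exact: ffunE.
by rewrite !big_cons coefD IH.
Qed.

Lemma coef_basis g h : coef (basisElt g) h = (h == g)%:R.
Proof. exact: ffunE. Qed.

Lemma coef_mul x y g :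
  coef (grMul x y) g = \sum_(h : gT) coef x h * coef y (h^-1 * g)%g.
Proof. exact: ffunE. Qed.

Fact grMulA : associative grMul.
Proof.
move=> x y z; apply: coefP => g; rewrite !coef_mul.
under eq_bigr => k _ do rewrite coef_mul mulr_sumr.
under [RHS]eq_bigr => h _ do rewrite coef_mul mulr_suml.
rewrite [RHS]exchange_big; apply: eq_bigr => k _.
rewrite [RHS](reindex_inj (mulgI k)); apply: eq_bigr => h _.
by rewrite mulrA mulKg invMg mulgA.
Qed.

Fact grMul1l : left_id grOne grMul.
Proof.
move=> x; apply: coefP => g; rewrite coef_mul (bigD1 1%g) //= big1 => [|h hN1].
  by rewrite coef_basis eqxx mul1r invg1 mul1g addr0.
by rewrite coef_basis (negPf hN1) mul0r.
Qed.

Fact grMul1r : right_id grOne grMul.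
Proof.
move=> x; apply: coefP => g; rewrite coef_mul (bigD1 g) //= big1 => [|h hNg].
  by rewrite mulVg coef_basis eqxx mulr1 addr0.
by rewrite coef_basis -eq_mulVg1 (negPf hNg) mulr0.
Qed.

Fact grMulDl : left_distributive grMul +%R.
Proof.
move=> x y z; apply: coefP => g; rewrite coefD !coef_mul -big_split.
by apply: eq_bigr => h _; rewrite coefD mulrDl.
Qed.

Fact grMulDr : right_distributive grMul +%R.
Proof.
move=> x y z; apply: coefP => g; rewrite coefD !coef_mul -big_split.
by apply: eq_bigr => h _; rewrite coefD mulrDr.
Qed.

Fact grOne_neq0 : grOne != 0.
Proof.
apply/eqP => /(congr1 (fun x => coef x 1%g)).
rewrite coef_basis eqxx => e.
have : coef (0 : RG) 1%g = 0 by exact: ffunE.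
by rewrite -e => /eqP; rewrite oner_eq0.
Qed.

HB.instance Definition _ := GRing.Zmodule_isNzRing.Build RG
  grMulA grMul1l grMul1r grMulDl grMulDr grOne_neq0.

Lemma coefM x y g :
  coef (x * y) g = \sum_(h : gT) coef x h * coef y (h^-1 * g)%g.
Proof. exact: coef_mul. Qed.

End GroupRing.

Section FinGroupRing.
Variables (R : finNzRingType) (gT : finGroupType).
HB.instance Definition _ := Finite.copy (groupRing R gT) {ffun gT -> R}.
(* Units are decided by exhaustive search: [unit] is "has a two-sided inverse". *)
HB.instance Definition _ := FinRing.isNzRing.Build (groupRing R gT).
End FinGroupRing.

Record involution (R : pzRingType) := Involution {
  star :> R -> R;
  starD : forall x y, star (x + y) = star x + star y;
  starM : forall x y, star (x * y) = star y * star x;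
  starK : forall x, star (star x) = x }.

Definition projection (R : pzRingType) (s : involution R) (e : R) : Prop :=
  s e = e /\ e = e ^+ 2.

Definition star_clean (R : unitRingType) (s : involution R) : Prop :=
  forall x : R, exists u e : R,
    [/\ u \is a GRing.unit, projection s e & x = u + e].

Definition expgz (gT : finGroupType) (g : gT) (v : int) : gT :=
  match v with
  | Posz k => g ^+ k
  | Negz k => g ^- k.+1
  end%g.

Definition sigma2_fun (F : finFieldType) (gT : finGroupType) (q : nat) (v : int)
    (x : groupRing F gT) : groupRing F gT :=
  \sum_(g : gT) (coef x g ^+ q) *: basisElt F (expgz g v).

Section Sigma2.
Variables (p k q n : nat) (F : finFieldType) (gT : finGroupType) (v : int).
Hypothesis charF : p \in [pchar F].
Hypothesis q_pow : q = (p ^ k)%N.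
Hypothesis cardF : #|F| = (q ^ 2)%N.
Hypothesis abG : abelian [set: gT].
Hypothesis nE : n = exponent [set: gT].
Hypothesis v_sqr : (v ^+ 2 = 1 %[mod n])%Z.

Lemma expgzM (g h : gT) : expgz (g * h)%g v = (expgz g v * expgz h v)%g.
Proof.
have gh (a b : gT) : commute a b by apply: (centsP abG); rewrite inE.
case: v => j /=; first by rewrite expgMn.
by rewrite (expgMn _ (gh g h)) invMg; apply: gh.
Qed.

Lemma expgzK : involutive (fun g : gT => expgz g v).
Proof.
move=> g.
have -> : expgz (expgz g v) v = (g ^+ (`|v| ^ 2))%g.
  case: v => j /=; first by rewrite -expgM.
  by rewrite expVgn invgK -expgM.
have v_sqrN : (`|v| ^ 2)%N = 1 %[mod n].
  have vE : v ^+ 2 = (`|v| ^ 2)%N by rewrite -abszX gez0_abs ?sqr_ge0.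
  by apply: (can_inj absz_nat); rewrite -!modz_nat -vE; exact: v_sqr.
have g1 : (g ^+ n = 1)%g by rewrite nE expg_exponent ?inE.
by rewrite -(expg_mod _ g1) v_sqrN expg_mod ?expg1.
Qed.

Lemma coef_sigma2 x g :
  coef (sigma2_fun q v x : groupRing F gT) g = coef x (expgz g v) ^+ q.
Proof.
rewrite coef_sum (bigD1 (expgz g v)) //= big1 => [|h hNg].
  by rewrite coefZ coef_basis (expgzK g) eqxx mulr1 addr0.
rewrite coefZ coef_basis; case: eqP => [gE|]; last by rewrite mulr0.
by move: hNg; rewrite gE (expgzK h) eqxx.
Qed.

Lemma exp_qD (a b : F) : (a + b) ^+ q = a ^+ q + b ^+ q.
Proof. by rewrite q_pow exprDn_pchar // pnatX pnatE ?(pcharf_prime charF) // charF. Qed.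

Lemma exp_q_sum I (r : seq I) (f : I -> F) :
  (\sum_(i <- r) f i) ^+ q = \sum_(i <- r) f i ^+ q.
Proof.
apply: (big_morph _ exp_qD).
by rewrite expr0n q_pow expn_eq0 -leqn0 leqNgt prime_gt0 ?(pcharf_prime charF).
Qed.

Fact sigma2D (x y : groupRing F gT) :
  sigma2_fun q v (x + y) = sigma2_fun q v x + sigma2_fun q v y.
Proof.
by apply: coefP => g; rewrite coefD !coef_sigma2 coefD exp_qD.
Qed.

Fact sigma2M (x y : groupRing F gT) :
  sigma2_fun q v (x * y) = sigma2_fun q v y * sigma2_fun q v x.
Proof.
apply: coefP => g; rewrite coefM coef_sigma2 coefM exp_q_sum.
have gh (a b : gT) : commute a b by apply: (centsP abG); rewrite inE.
have inj : injective (fun h : gT => expgz (h^-1 * g)%g v).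
  by move=> h1 h2 /(inv_inj expgzK) /mulIg /invg_inj.
rewrite (reindex_inj inj); apply: eq_bigr => h _ /=.
rewrite exprMn mulrC !coef_sigma2; congr (coef y _ ^+ q * _).
apply: (mulgI (expgz (h^-1 * g)%g v)).
by rewrite mulKVg -expgzM -mulgA (gh g) mulKg.
Qed.

Fact sigma2K (x : groupRing F gT) : sigma2_fun q v (sigma2_fun q v x) = x.
Proof.
apply: coefP => g.
by rewrite !coef_sigma2 (expgzK g) -exprM -[(q * q)%N]/(q ^ 2)%N -cardF expf_card.
Qed.

Definition sigma2 : involution (groupRing F gT) :=
  Involution sigma2D sigma2M sigma2K.

End Sigma2.

(* Main.v *)
Require Import Defs.
From mathcomp Require Import all_boot all_order all_fingroup all_algebra all_solvable.
From HB Require Import structures.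
From mathcomp Require Import finfield ring zify.

Set Implicit Arguments.
Unset Strict Implicit.
Unset Printing Implicit Defensive.

Import GRing.Theory.

(** Write [Q = q ^ 2] for the order of [F] and [R] for the group ring.

    In a finite commutative ring every element is the sum of a unit and an
    idempotent, while an idempotent [e] is the sum of a unit and an idempotent
    [f] only for [f = 1 - e].  Hence [R] is star-clean exactly when the
    involution fixes every idempotent ([sigma2_clean_fix_idempotents]).

    Two maps of [R] only move the group elements and leave the coefficients
    alone: [x |-> x ^+ Q], which is induced by [g |-> g ^+ Q] ([expr_card]), and
    [x |-> sigma2 x ^+ q], which is induced by [g |-> (g ^ v) ^+ q]
    ([sigma2_expr]).  On idempotents the first is the identity and the second
    agrees with the involution.

    If [Q ^ t] is congruent to [q v] modulo [m], these maps can be compared on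
    an idempotent [e].  A high power [Q ^ N] kills the Sylow subgroup, so
    [e = e ^+ (Q ^ N)] is supported on [H]; there the map induced by
    [g |-> (g ^ v) ^+ q] is the [t]-th iterate of the one induced by
    [g |-> g ^+ Q], which fixes [e] ([fix_idempotents_of_power]).

    Conversely, suppose that all idempotents are fixed, and let [h] in [H] have
    order [m].  Since [Q] is prime to [m], the map [g |-> g ^+ Q] permutes the
    orbit of [h], so that the orbit sum [s] satisfies [s ^+ Q = s].  Lagrange
    interpolation over [F] writes such an element as an [F]-combination of
    idempotents ([frobenius_fixed_span]), so the [F]-linear map induced by
    [g |-> (g ^ v) ^+ q] fixes [s].  It must then reach [h] from some point of
    the orbit, which is the required congruence ([power_of_fix_idempotents]). *)

(** * Star-clean finite commutative rings *)

Section StarCleanRings.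
Local Open Scope ring_scope.

Lemma idempotentX (R : pzRingType) (e : R) n :
  e = e ^+ 2 -> (0 < n)%N -> e ^+ n = e.
Proof.
move=> ee; case: n => // n _; elim: n => // n IHn.
by rewrite exprS IHn -expr2 -ee.
Qed.

(** The powers of [x] are eventually periodic by the pigeonhole principle, and
    an exponent that is both a multiple of the period and past the preperiod
    gives an idempotent. *)
Lemma finRing_idempotent_power (R : finNzRingType) (x : R) :
  exists2 N, (0 < N)%N & x ^+ N = (x ^+ N) ^+ 2.
Proof.
have /injectivePn[i [j neq_ij xij]] :
    ~~ injectiveb (fun i : 'I_#|R|.+1 => x ^+ i).
  by apply/negP=> /injectiveP /leq_card; rewrite card_ord ltnn.
wlog lt_ij : i j neq_ij xij / (i < j)%N.
  move=> IH; case: (ltngtP i j) => [|/IH|/val_inj eq_ij]; first exact: IH.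
    by apply; rewrite // eq_sym.
  by rewrite eq_ij eqxx in neq_ij.
have period c a : (i <= a)%N -> x ^+ (a + (j - i) * c) = x ^+ a.
  move=> le_ia; elim: c => [|c IHc]; first by rewrite muln0 addn0.
  rewrite -IHc; have -> : (a + (j - i) * c.+1 = j + (a - i + (j - i) * c))%N by nia.
  by rewrite exprD -xij -exprD; congr (x ^+ _); nia.
(* The factor [i.+1] pushes this multiple of the period [j - i] past [i]. *)
exists ((j - i) * i.+1)%N; first by nia.
by rewrite -exprM muln2 -addnn period //; nia.
Qed.

Lemma finRing_unitr (R : finComUnitRingType) (x : R) :
  (forall y, x * y = 0 -> y = 0) -> x \is a GRing.unit.
Proof.
move=> x_reg; have /injF_bij[y _ xy] : injective ( *%R x).
  move=> a b xab; apply/eqP; rewrite -subr_eq0; apply/eqP/x_reg.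
  by rewrite mulrBr xab subrr.
by apply/unitrPr; exists (y 1); apply: xy.
Qed.

Lemma star0 (R : pzRingType) (s : involution R) : s 0 = 0.
Proof. by apply: (@addrI _ (s 0)); rewrite -starD !addr0. Qed.

Lemma star1 (R : pzRingType) (s : involution R) : s 1 = 1.
Proof. by rewrite -[LHS]mulr1 -{2}(starK s 1) -starM mulr1 starK. Qed.

Lemma starN (R : pzRingType) (s : involution R) x : s (- x) = - s x.
Proof. by apply/eqP; rewrite -addr_eq0 -starD addNr star0. Qed.

(** In [e = u + f] the unit [u = e - f] annihilates both [e * f] and
    [(1 - e) * (1 - f)], so these vanish and [e = 1 - f], which is a projection
    because [f] is. *)
Lemma star_clean_fix_idempotents (R : comUnitRingType) (s : involution R) e :
  star_clean s -> e = e ^+ 2 -> s e = e.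
Proof.
move=> s_clean ee; have [u [f [u_unit [sf ff] e_uf]]] := s_clean e.
have uE : u = e - f by rewrite e_uf addrK.
have ef0 : e * f = 0.
  apply: (mulrI u_unit); rewrite mulr0 uE.
  by transitivity (e ^+ 2 * f - e * f ^+ 2); [ring | rewrite -ee -ff subrr].
have compl0 : (1 - e) * (1 - f) = 0.
  apply: (mulrI u_unit); rewrite mulr0 uE.
  transitivity ((e - e ^+ 2) * (1 - f) - (1 - e) * (f - f ^+ 2)); first by ring.
  by rewrite -ee -ff !subrr mul0r mulr0 subrr.
have -> : e = 1 - f.
  apply/eqP; rewrite -subr_eq0; apply/eqP.
  transitivity (e * f - (1 - e) * (1 - f)); first by ring.
  by rewrite ef0 compl0 subrr.
by rewrite starD starN sf star1.
Qed.

(** Let [x ^+ N] be idempotent.  On the factor of the ring cut out by [x ^+ N]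
    the element [x] is invertible, and on the complementary factor it is
    nilpotent, so that [x - 1] is invertible there.  Subtracting the idempotent
    [1 - x ^+ N] from [x] therefore leaves a unit. *)
Lemma fix_idempotents_star_clean (R : finComUnitRingType) (s : involution R) :
  (forall e, e = e ^+ 2 -> s e = e) -> star_clean s.
Proof.
move=> s_fix x; have [N N_gt0 xNN] := finRing_idempotent_power x.
have ee : 1 - x ^+ N = (1 - x ^+ N) ^+ 2.
  transitivity (1 - 2 * x ^+ N + x ^+ N); first by ring.
  by rewrite {2}xNN; ring.
exists (x - (1 - x ^+ N)), (1 - x ^+ N); split; last by rewrite subrK.
  apply: finRing_unitr => y uy0.
  have xNy0 : x ^+ N * y = 0.
    have : x ^+ N * (x * y) = 0.
      transitivity (x ^+ N * ((x - (1 - x ^+ N)) * y) + (x ^+ N - (x ^+ N) ^+ 2) * y).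
        by ring.
      by rewrite -xNN uy0 subrr mulr0 mul0r addr0.
    rewrite mulrA -exprSr => xSNy0.
    rewrite xNN -exprM -(subnK (_ : N.+1 <= N * 2)%N); last by lia.
    by rewrite exprD -mulrA xSNy0 mulr0.
  have xy : x * y = y.
    apply/eqP; rewrite -subr_eq0; apply/eqP.
    transitivity ((x - (1 - x ^+ N)) * y - x ^+ N * y); first by ring.
    by rewrite uy0 xNy0 subrr.
  have iter_xy j : x ^+ j * y = y.
    by elim: j => [|j IHj]; rewrite ?mul1r // exprSr -mulrA xy.
  by rewrite -(iter_xy N).
by split=> //; apply: s_fix.
Qed.

End StarCleanRings.

(** * Elements fixed by the Frobenius power map *)

Section FrobeniusFixedElements.
Local Open Scope ring_scope.
Variables (F : finFieldType) (A : algType F).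

(** A polynomial that vanishes on [F] is a multiple of ['X^#|F| - 'X], and [x]
    is a root of the latter.  So a polynomial evaluated at [x] depends only on
    the function that it defines on [F], which turns identities between
    functions on [F] into identities in [A]. *)
Lemma horner_alg_finField_eq0 (x : A) (f : {poly F}) :
  x ^+ #|F| = x -> (forall a, f.[a] = 0) -> horner_alg x f = 0.
Proof.
move=> xF f0.
have : 'X^#|F| - 'X %| f.
  rewrite finField_genPoly -big_enum /=; apply: uniq_roots_dvdp.
    by apply/allP=> a _; apply/rootP/f0.
  by rewrite uniq_rootsE enum_uniq.
case/dvdpP=> g ->; rewrite rmorphM rmorphB rmorphXn /= horner_algX xF.
by rewrite subrr mulr0.
Qed.

Lemma finField_delta_poly (a : F) :
  exists f : {poly F}, forall b, f.[b] = (b == a)%:R.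
Proof.
exists (1 - ('X - a%:P) ^+ #|F|.-1) => b; rewrite !hornerE -[b == a]subr_eq0.
have F_gt1 := finNzRing_gt1 F.
case: eqP => [->|/eqP ba_neq0].
  by rewrite expr0n gtn_eqF ?subr0 // -ltnS prednK ?(ltnW F_gt1).
have -> : (b - a) ^+ #|F|.-1 = 1; last by rewrite subrr.
by apply: (mulfI ba_neq0); rewrite -exprS prednK ?(ltnW F_gt1) // expf_card mulr1.
Qed.

(** The indicator function of each [a] in [F] is idempotent, and the identity
    of [F] is the combination of these indicators with coefficients [a];
    evaluating the corresponding polynomials at [x] transports both facts. *)
Lemma frobenius_fixed_span (x : A) :
  x ^+ #|F| = x ->
  exists2 e : F -> A, (forall a, e a = e a ^+ 2) & x = \sum_a a *: e a.
Proof.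
move=> xF; have [f fE] := fin_all_exists finField_delta_poly.
exists (fun a => horner_alg x (f a)) => [a|]; apply/eqP; rewrite -subr_eq0; apply/eqP.
  rewrite -rmorphXn -rmorphB; apply: horner_alg_finField_eq0 => // b.
  by rewrite !hornerE fE; case: eqP => _; rewrite ?expr1n ?expr0n subrr.
transitivity (horner_alg x ('X - \sum_a a *: f a)).
  rewrite rmorphB /= horner_algX rmorph_sum /=; congr (_ - _); apply: eq_bigr => a _.
  by rewrite linearZ /= mulr_algl.
apply: horner_alg_finField_eq0 => // b.
rewrite hornerD hornerN hornerX horner_sum (bigD1 b) //= big1 => [|a].
  by rewrite hornerZ fE eqxx mulr1 addr0 subrr.
by rewrite hornerZ fE eq_sym => /negPf->; rewrite mulr0.
Qed.

End FrobeniusFixedElements.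

(** * The group ring as an algebra, and maps induced on it by maps of the group *)

Section GroupAlgebra.
Local Open Scope ring_scope.
Variables (R : comNzRingType) (gT : finGroupType).
Local Notation RG := (groupRing R gT).

Fact groupRing_scalerAl (a : R) (x y : RG) : a *: (x * y) = a *: x * y.
Proof.
apply: Defs.coefP => g; rewrite Defs.coefZ !Defs.coefM mulr_sumr.
by apply: eq_bigr => h _; rewrite Defs.coefZ mulrA.
Qed.

Fact groupRing_scalerAr (a : R) (x y : RG) : a *: (x * y) = x * (a *: y).
Proof.
apply: Defs.coefP => g; rewrite Defs.coefZ !Defs.coefM mulr_sumr.
by apply: eq_bigr => h _; rewrite Defs.coefZ mulrCA.
Qed.

HB.instance Definition _ := GRing.Lmodule_isLalgebra.Build R RG groupRing_scalerAl.
HB.instance Definition _ := GRing.Lalgebra_isAlgebra.Build R RG groupRing_scalerAr.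

Lemma coef_sum_cond I (r : seq I) (P : pred I) (f : I -> RG) g :
  coef (\sum_(i <- r | P i) f i) g = \sum_(i <- r | P i) coef (f i) g.
Proof. by rewrite -big_filter Defs.coef_sum big_filter. Qed.

Lemma basisEltM (g h : gT) : basisElt R (g * h)%g = basisElt R g * basisElt R h.
Proof.
apply: Defs.coefP => c; rewrite Defs.coefM (bigD1 g) //= big1 => [|d].
  by rewrite !coef_basis eqxx mul1r addr0 -(inj_eq (mulgI g) (g^-1 * c)%g) mulKVg.
by rewrite coef_basis => /negPf->; rewrite mul0r.
Qed.

Lemma basisEltX (g : gT) n : basisElt R (g ^+ n)%g = basisElt R g ^+ n.
Proof. by elim: n => // n IHn; rewrite expgS basisEltM IHn exprS. Qed.

Lemma groupRing_mulC : abelian [set: gT] -> forall x y : RG, x * y = y * x.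
Proof.
move=> /centsP abG x y; apply: Defs.coefP => g; rewrite !Defs.coefM.
have inj : injective (fun h : gT => h^-1 * g)%g by move=> a b /mulIg/invg_inj.
rewrite (reindex_inj inj); apply: eq_bigr => h _ /=.
rewrite mulrC; congr (coef y _ * _).
by rewrite invMg invgK -mulgA (abG h) ?inE // mulKg.
Qed.

Definition pushforward (f : gT -> gT) (x : RG) : RG :=
  \sum_g coef x g *: basisElt R (f g).

Lemma pushforward_id x : pushforward id x = x.
Proof.
apply: Defs.coefP => g; rewrite Defs.coef_sum (bigD1 g) //= big1 => [|h].
  by rewrite Defs.coefZ coef_basis eqxx mulr1 addr0.
by rewrite Defs.coefZ coef_basis eq_sym => /negPf->; rewrite mulr0.
Qed.

Lemma eq_pushforward f1 f2 x : f1 =1 f2 -> pushforward f1 x = pushforward f2 x.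
Proof. by move=> eqf; apply: eq_bigr => g _; rewrite eqf. Qed.

Fact pushforward_is_linear f : linear (pushforward f).
Proof.
move=> a x y; rewrite scaler_sumr -big_split; apply: eq_bigr => g _ /=.
by rewrite Defs.coefD Defs.coefZ scalerDl scalerA.
Qed.
HB.instance Definition _ f :=
  GRing.isLinear.Build R RG RG _ (pushforward f) (pushforward_is_linear f).

Lemma pushforward_basisElt (f : gT -> gT) g :
  pushforward f (basisElt R g) = basisElt R (f g).
Proof.
rewrite /pushforward (bigD1 g) //= big1 => [|h].
  by rewrite coef_basis eqxx scale1r addr0.
by rewrite coef_basis => /negPf->; rewrite scale0r.
Qed.

(** Functoriality: composing induced maps reduces the comparison of powers in
    the group ring to that of powers in the group. *)
Lemma pushforward_comp f1 f2 x :
  pushforward f1 (pushforward f2 x) = pushforward (f1 \o f2) x.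
Proof.
rewrite [pushforward f2 x]/pushforward linear_sum; apply: eq_bigr => g _.
by rewrite linearZ /= pushforward_basisElt.
Qed.

End GroupAlgebra.

(** * Frobenius powers in the group ring *)

Section FrobeniusPowers.
Local Open Scope ring_scope.
Variables (p k q : nat) (F : finFieldType) (gT : finGroupType).
Hypothesis charF : p \in [pchar F].
Hypothesis q_pow : q = (p ^ k)%N.
Hypothesis cardF : #|F| = (q ^ 2)%N.
Hypothesis abG : abelian [set: gT].
Local Notation FG := (groupRing F gT).

Lemma groupRing_exprD_ppow (x y : FG) j :
  (x + y) ^+ (p ^ j) = x ^+ (p ^ j) + y ^+ (p ^ j).
Proof.
have charFG : p \in [pchar FG] by rewrite pchar_lalg.
elim: j => // j IHj; rewrite expnSr !exprM IHj.
by rewrite -!(pFrobenius_autE charFG) pFrobenius_autD_comm //; apply: groupRing_mulC.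
Qed.

Lemma groupRing_sum_expr_ppow I (r : seq I) (f : I -> FG) j :
  (\sum_(i <- r) f i) ^+ (p ^ j) = \sum_(i <- r) f i ^+ (p ^ j).
Proof.
have pj_gt0 : (0 < p ^ j)%N by rewrite expn_gt0 prime_gt0 ?(pcharf_prime charF).
elim: r => [|i r IHr]; first by rewrite !big_nil expr0n gtn_eqF.
by rewrite !big_cons groupRing_exprD_ppow IHr.
Qed.

(** A coefficient [a] is raised to the power [q] once by [sigma2_fun] and once
    more here, and [a ^+ (q * q) = a]; this is what makes the composite linear
    over [F]. *)
Lemma sigma2_expr v (x : FG) :
  sigma2_fun q v x ^+ q = pushforward (fun g => expgz g v ^+ q)%g x.
Proof.
rewrite {2}q_pow groupRing_sum_expr_ppow -q_pow; apply: eq_bigr => g _.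
by rewrite exprZn -exprM mulnn -cardF expf_card basisEltX.
Qed.

Lemma expr_card (x : FG) : x ^+ #|F| = pushforward (fun g => g ^+ #|F|)%g x.
Proof.
have cardFp : #|F| = (p ^ (k * 2))%N by rewrite cardF q_pow expnM.
rewrite -{1}(pushforward_id x) {1}cardFp groupRing_sum_expr_ppow -cardFp.
by apply: eq_bigr => g _; rewrite exprZn expf_card basisEltX.
Qed.

Lemma expr_card_iter (x : FG) N :
  x ^+ (#|F| ^ N) = pushforward (fun g => g ^+ (#|F| ^ N))%g x.
Proof.
elim: N => [|N IHN]; first by rewrite expn0 expr1 pushforward_id.
rewrite expnSr exprM IHN expr_card pushforward_comp.
by apply: eq_pushforward => g /=; rewrite expgM.
Qed.

End FrobeniusPowers.

(** * Integer powers of group elements *)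

Section IntegerPowers.
Variables (gT : finGroupType).

Lemma expgz_eq_expg (g : gT) v j :
  (expgz g v == g ^+ j)%g = (v == j%:Z %[mod #[g]%g])%Z.
Proof.
case: v => i /=; first by rewrite eq_expg_mod_order !modz_nat.
rewrite eqz_mod_dvd NegzE -opprD dvdzE abszN -PoszD absz_nat order_dvdn.
by rewrite eq_invg_mul expgD.
Qed.

Lemma expgzX (g : gT) v n : (expgz g v ^+ n)%g = expgz g (n%:Z * v)%R.
Proof.
case: n => [|n]; first by rewrite mul0r.
case: v => i; first by rewrite -PoszM /= mulnC expgM.
by rewrite NegzE mulrN -PoszM -NegzE /= expgVn -expgM mulnC.
Qed.

Lemma expgz_expg (g : gT) v n : (expgz (g ^+ n) v = expgz g v ^+ n)%g.
Proof. by case: v => i /=; rewrite ?expgVn -!expgM mulnC. Qed.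

End IntegerPowers.

(** * When the involution fixes all idempotents *)

Section FixedIdempotents.
Local Open Scope ring_scope.
Variables (p k q n : nat) (F : finFieldType) (gT : finGroupType) (v : int).
Hypothesis charF : p \in [pchar F].
Hypothesis q_pow : q = (p ^ k)%N.
Hypothesis cardF : #|F| = (q ^ 2)%N.
Hypothesis abG : abelian [set: gT].
Hypothesis nE : n = exponent [set: gT].
Hypothesis v_sqr : (v ^+ 2 = 1 %[mod n])%Z.
Local Notation FG := (groupRing F gT).
Local Notation star2 := (sigma2 charF q_pow cardF abG nE v_sqr).

Lemma sigma2_clean_fix_idempotents :
  star_clean star2 <-> (forall e : FG, e = e ^+ 2 -> star2 e = e).
Proof.
(* Commutativity of the group ring depends on that of the group, so the
   commutative ring structure is only packed locally. *)
pose comFG := HB.pack FG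
  (GRing.PzRing_hasCommutativeMul.Build FG (groupRing_mulC abG)) : finComUnitRingType.
split=> [sc e|]; first exact: (@star_clean_fix_idempotents comFG star2).
exact: (@fix_idempotents_star_clean comFG star2).
Qed.

(** On an idempotent [e], both the involution and its [q]-th power have the same
    value, and [e] equals all of its powers.  The hypothesis says that the maps
    inducing these agree on [#|F| ^ N]-th powers in the group, which is where
    [e = e ^+ (#|F| ^ N)] is supported. *)
Lemma fix_idempotents_of_power N t :
  (forall g : gT, expgz (g ^+ (#|F| ^ N)) v ^+ q = (g ^+ (#|F| ^ N)) ^+ (#|F| ^ t))%g ->
  forall e : FG, e = e ^+ 2 -> star2 e = e.
Proof.
move=> vE e ee.
have F_gt0 : (0 < #|F|)%N by apply: ltnW; exact: finNzRing_gt1.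
have q_gt0 : (0 < q)%N by move: F_gt0; rewrite cardF expn_gt0 orbF.
have eF j : e ^+ (#|F| ^ j) = e by rewrite idempotentX // expn_gt0 F_gt0.
have see : star2 e = star2 e ^+ 2 by rewrite expr2 -starM -expr2 -ee.
rewrite -[LHS](idempotentX see q_gt0) (sigma2_expr charF q_pow cardF abG).
rewrite -{1}(eF N) (expr_card_iter charF q_pow cardF abG) pushforward_comp.
rewrite (eq_pushforward _ vE) -[RHS](eF (N + t)%N) (expr_card_iter charF q_pow cardF abG).
by apply: eq_pushforward => g /=; rewrite expnD expgM.
Qed.

(** The sum of the orbit of [h] under [g |-> g ^+ #|F|] is fixed by the Frobenius
    power map, hence is a combination of idempotents, hence is fixed by the
    linear map [x |-> star2 x ^+ q].  As its coefficient at [h] is [1], that map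
    sends some point of the orbit to [h]. *)
Lemma power_of_fix_idempotents (h : gT) :
  coprime #|F| #[h]%g -> (forall e : FG, e = e ^+ 2 -> star2 e = e) ->
  exists2 t, (0 < t)%N & (expgz h v ^+ q = h ^+ (#|F| ^ t))%g.
Proof.
move=> co_h fix_e; set Q := #|F|.
have q_gt0 : (0 < q)%N.
  by move: (finNzRing_gt1 F); rewrite cardF; case: (q).
(* A period of the orbit: by Euler's theorem, [Q ^ d] is [1] modulo the
   order of [h]. *)
pose d := totient #[h]%g.
have d_gt0 : (0 < d)%N by rewrite totient_gt0 order_gt0.
have hQd c : (h ^+ (Q ^ (d * c)) = h)%g.
  rewrite -[RHS]expg1; apply/eqP; rewrite eq_expg_mod_order expnM -modnXm.
  by rewrite Euler_exp_totient // modnXm exp1n.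
pose O := [set (h ^+ (Q ^ i))%g | i : 'I_d].
have memO i : (h ^+ (Q ^ i))%g \in O.
  apply/imsetP; exists (Ordinal (ltn_pmod i d_gt0)) => //=.
  by rewrite {1}(divn_eq i d) mulnC expnD expgM hQd.
pose s : FG := \sum_(g in O) basisElt F g.
have sQ : s ^+ #|F| = s.
  rewrite (expr_card charF q_pow cardF abG) /s linear_sum /=.
  under eq_bigr do rewrite pushforward_basisElt.
  (* On the orbit, raising to the power [Q ^ d.-1] inverts raising to the
     power [Q]. *)
  have inj : {in O &, injective (fun g => g ^+ Q)%g}.
    apply: (@can_in_inj _ _ _ _ (fun g => g ^+ (Q ^ d.-1))%g) => _ /imsetP[i _ ->] /=.
    rewrite -!expgM -expnS prednK // mulnC expgM.
    by have := hQd 1%N; rewrite muln1 => ->.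
  rewrite -(big_imset _ inj) /=; apply: eq_bigl => g; congr (g \in pred_of_set _).
  apply/eqP; rewrite eqEcard (card_in_imset inj) leqnn andbT.
  by apply/subsetP=> _ /imsetP[_ /imsetP[i _ ->] ->]; rewrite -expgM -expnSr memO.
have phis : pushforward (fun g => expgz g v ^+ q)%g s = s.
  have [e ee ->] := frobenius_fixed_span sQ.
  rewrite linear_sum; apply: eq_bigr => a _ /=; rewrite linearZ /=; congr (_ *: _).
  rewrite -(sigma2_expr charF q_pow cardF abG).
  by rewrite -[sigma2_fun q v (e a)]/(star2 (e a)) fix_e // idempotentX.
have : Defs.coef s h != 0.
  rewrite /s coef_sum_cond (bigD1 h) /=; last by have := memO 0%N; rewrite expn0 expg1.
  rewrite coef_basis eqxx big1 ?addr0 ?oner_neq0 // => g /andP[_ /negPf].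
  by rewrite coef_basis eq_sym => ->.
rewrite -phis /s linear_sum coef_sum_cond.
case: (pickP [pred g in O | h == expgz g v ^+ q]%g) => [g|hN]; last first.
  rewrite big1 ?eqxx // => g Og; have:= hN g; rewrite /= Og /= pushforward_basisElt.
  by rewrite coef_basis => ->.
case/andP=> /imsetP[i _ ->] /eqP hE _.
have hE' : h = ((expgz h v ^+ q) ^+ (Q ^ i))%g.
  by rewrite {1}hE expgz_expg -!expgM mulnC.
(* The exponent [t] must make [i + t] a multiple of the period [d] and be
   positive even when [i = 0]. *)
exists (d * i.+1 - i)%N; first by nia.
rewrite {2}hE' -[in RHS]expgM -expnD subnKC; last by nia.
by rewrite -!expgz_expg -expgM mulnC expgM hQd.
Qed.

End FixedIdempotents.

(** * The complement of the Sylow subgroup *)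

(** The exponent [N = logn p #|P|] suffices, as [#|P|] then divides
    [(p ^ k) ^ N]. *)
Lemma sylow_complement_power (p k : nat) (gT : finGroupType) (P H : {group gT}) :
    (0 < k)%N -> p.-Sylow([set: gT])%g P -> (P \x H = [set: gT])%g ->
  exists N, forall g : gT, (g ^+ ((p ^ k) ^ N) \in H)%g.
Proof.
move=> k_gt0 /pHall_pgroup/p_natP[l cardP] defG; exists l => g.
have [x [y [Px Hy -> _]]] := mem_dprod defG (in_setT g).
have /dprodP[_ _ /centsP cHP _] := defG.
rewrite expgMn; last by apply: commute_sym; apply: cHP.
have /eqP-> : (x ^+ ((p ^ k) ^ l) == 1)%g; last by rewrite mul1g groupX.
rewrite -order_dvdn (dvdn_trans (order_dvdG Px)) // cardP -expnM.
by rewrite dvdn_exp2l // leq_pmull.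
Qed.

Lemma sylow_complement_p'group (p : nat) (gT : finGroupType) (G P H : {group gT}) :
  p.-Sylow(G)%g P -> (P \x H = G)%g -> (p^'.-group H)%g.
Proof.
case/and3P=> _ _ p'PG defG; move: p'PG; rewrite -divgS; last first.
  by rewrite -(dprodW defG) mulG_subl.
by rewrite -(dprod_card defG) mulKn.
Qed.

Theorem theorem1p2 (p k q n m : nat) (F : finFieldType) (gT : finGroupType)
    (P H : {group gT}) (v : int)
    (k_gt0 : (0 < k)%N)
    (q_pow : q = (p ^ k)%N)
    (charF : p \in [pchar F]%R)
    (cardF : #|F| = (q ^ 2)%N)
    (abG : abelian [set: gT])
    (nE : n = exponent [set: gT])
    (sylP : p.-Sylow([set: gT])%g P)
    (defG : (P \x H = [set: gT])%g)
    (mE : m = exponent H)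
    (v_sqr : (v ^+ 2 = 1 %[mod n])%Z) :
  star_clean (sigma2 charF q_pow cardF abG nE v_sqr) <->
  exists t : nat,
    (0 < t)%N /\ ((q ^ (2 * t))%N%:Z = q%:Z * v %[mod m%:Z])%Z.
Proof.
rewrite sigma2_clean_fix_idempotents; split=> [fix_e | [t [_ tE]]].
- have nilH : nilpotent H by rewrite abelian_nil // (abelianS (subsetT H)).
  have [h Hh hE] := exponent_witness nilH.
  have co_h : coprime #|F| #[h]%g.
    rewrite cardF q_pow -expnM (pnat_coprime (pi := p)) ?pnatX ?pnat_id //.
      exact: pcharf_prime charF.
    by apply: pnat_dvd (sylow_complement_p'group sylP defG); apply: order_dvdG.
  have [t t_gt0 /eqP] := power_of_fix_idempotents co_h fix_e.
  rewrite expgzX expgz_eq_expg -hE -mE => /eqP tE; exists t.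
  by rewrite tE cardF -expnM.
have [N HN] : exists N, forall g : gT, (g ^+ (#|F| ^ N) \in H)%g.
  rewrite cardF q_pow -expnM; apply: sylow_complement_power sylP defG.
  by rewrite muln_gt0 k_gt0.
apply: (@fix_idempotents_of_power _ _ _ _ _ _ _ _ _ _ _ _ _ N t) => g.
move: (HN g); set w := (g ^+ _)%g => Hw.
have order_w : (#[w]%g %| m%:Z)%Z by rewrite dvdzE mE dvdn_exponent.
rewrite expgzX; apply/eqP; rewrite expgz_eq_expg cardF -expnM eqz_mod_dvd.
by rewrite (dvdz_trans order_w) // -eqz_mod_dvd tE.
Qed.
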